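(* Let $S$ be a multiplicatively idempotent, positive and pseudocomplemented semiring such that $1\in \operatorname{Stone}(S)$, and let $P$ be a prime ideal of $S$. Then the following statements are equivalent: (1) For each $s\in S$, if $s\in P$, then $s^* \notin P$. (2) For each $s\in S$, if $s\in P$, then $s^{**} \in P$. (3) $P \cap \operatorname{Dns}(S) = \emptyset$. (4) $P$ is a minimal prime ideal of $S$.
   Context: A semiring is a set $S$ with operations $+,\cdot$ such that $(S,+)$ is a commutative monoid with identity $0$, $(S,\cdot)$ is a commutative monoid with identity $1\neq 0$, multiplication distributes over addition, and $s\cdot 0=0$ for all $s\in S$. It is multiplicatively idempotent if $s^2=s$ for all $s\in S$. An ordered semiring is a semiring with a partial order $\leq$ such that $s\leq t$ implies $s+u\leq t+u$ for all $u$, and $s\leq t$, $0\leq u$ imply $su\leq tu$. It is positive if $0\leq s$ for all $s\in S$. In an ordered semiring $S$, an element $s$ is pseudocomplemented if there is an element $s^*\in S$ (necessarily unique, called the pseudocomplement of $s$) such that $ss^*=0$ and, for each $x\in S$, $sx=0$ implies $x\leq s^*$. $\operatorname{pcomp}(S)$ is the set of pseudocomplemented elements of $S$, and $S$ is a pseudocomplemented semiring if $S=\operatorname{pcomp}(S)$. Write $s^{**}=(s^* )^*$ when it exists. For $S$ positive, $s\in S$ is a Stone element if $s,s^*\in\operatorname{pcomp}(S)$ and $s^*+s^{**}=1$, and $\operatorname{Stone}(S)$ is the set of Stone elements; $s\in\operatorname{pcomp}(S)$ is dense if $s^*=0$, and $\operatorname{Dns}(S)$ is the set of dense elements. A nonempty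 subset $I\subseteq S$ is an ideal if $a+b\in I$ and $sa\in I$ for all $a,b\in I$, $s\in S$. An ideal $P\neq S$ is prime if $ab\in P$ implies $a\in P$ or $b\in P$. A minimal prime ideal of $S$ is a prime ideal that is minimal with respect to inclusion among all prime ideals of $S$. *)

(* Defs.v *)
From mathcomp Require Import all_boot all_order all_algebra.
From mathcomp Require Import classical_sets.

Set Implicit Arguments.
Unset Strict Implicit.
Unset Printing Implicit Defensive.

Import GRing.Theory.
Local Open Scope classical_set_scope.
Local Open Scope ring_scope.

(* The order is a plain relation rather than an Order.POrder structure:
   Hierarchy Builder cannot join comNzSemiRingType and porderType d in a new
   structure once Num.POrderedZmodule has been declared. *)
Record orderedSemiRing := OrderedSemiRing {
  osr_sort :> comNzSemiRingType;
  ole : rel osr_sort;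
  ole_refl : reflexive ole;
  ole_anti : antisymmetric ole;
  ole_trans : transitive ole;
  oleD2r : forall u s t, ole s t -> ole (s + u) (t + u);
  oleM2r : forall s t u, ole s t -> ole 0 u -> ole (s * u) (t * u)
}.

Notation "s ⊑ t" := (ole s t) (at level 70, no associativity).

Section Definitions.
Context (S : orderedSemiRing).
Implicit Types (s t x : S) (I P Q : set S).

Definition mul_idempotent := forall s, s ^+ 2 = s.

Definition positive_semiring := forall s, 0 ⊑ s.

Definition is_pcompl s t := s * t = 0 /\ forall x, s * x = 0 -> x ⊑ t.

Definition pcomp : set S := [set s | exists t, is_pcompl s t].

Definition pseudocomplemented := pcomp = setT.

(* Outside of pcomp, pcompl takes the junk value 0. *)
Definition pcompl s : S := xget 0 [set t | is_pcompl s t].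

Definition Stone : set S :=
  [set s | [/\ pcomp s, pcomp (pcompl s)
             & pcompl s + pcompl (pcompl s) = 1]].

Definition Dns : set S := [set s | pcomp s /\ pcompl s = 0].

Definition is_ideal I :=
  [/\ I !=set0, forall a b, I a -> I b -> I (a + b)
    & forall s a, I a -> I (s * a)].

Definition is_prime_ideal P :=
  [/\ is_ideal P, P <> setT & forall a b, P (a * b) -> P a \/ P b].

Definition is_minimal_prime_ideal P :=
  is_prime_ideal P /\ forall Q, is_prime_ideal Q -> Q `<=` P -> Q = P.

End Definitions.

Arguments pcomp S _ : clear implicits.
Arguments Stone S _ : clear implicits.
Arguments Dns S _ : clear implicits.

(* Main.v *)
Require Import Defs.
From mathcomp Require Import all_boot all_order all_algebra.
From mathcomp Require Import boolp classical_sets.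

Set Implicit Arguments.
Unset Strict Implicit.
Unset Printing Implicit Defensive.

Import GRing.Theory.
Local Open Scope classical_set_scope.
Local Open Scope ring_scope.

(* The hypothesis on 1 says that 0^* = 1, i.e. 1 is the top element.  For every
   s the element s + s^* is dense.  If Q is a prime ideal properly contained in
   P and s lies in P but not in Q, then s^* lies in Q, so P contains the dense
   element s + s^*.  Conversely, if P contains a dense element d, then the
   multiplicative set generated by d and the complement of P omits 0, so by
   Krull's lemma some prime ideal avoids it; that ideal is properly contained
   in P. *)

Section PrimeAvoidance.
Variable S : orderedSemiRing.
Implicit Types (I J M : set S).

(** An ideal [Q] maximal among those missing [M] is prime: if neither [a] nor [b] is in [Q], then
    [Q + Sa] and [Q + Sb] both meet [M], and a product of such elements lies in [Q + Sab]. *)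
Lemma exists_prime_ideal_avoiding M :
  M 1 -> ~ M 0 -> (forall a b, M a -> M b -> M (a * b)) ->
  exists Q : set S, is_prime_ideal Q /\ Q `&` M = set0.
Proof.
move=> M1 M0 MM.
(* Nonemptiness is left out, so that the union of the empty chain qualifies. *)
pose avoiding : set (set S) := [set I | [/\ forall a b, I a -> I b -> I (a + b),
  forall s a, I a -> I (s * a) & forall x, I x -> ~ M x]].
have [F Fav Ftot|Q [[QD QM QnM] Qmax]] := @Zorn_bigcup S avoiding.
  split=> [a b [I FI Ia] [J FJ Jb]|s a [I FI Ia]|x [I FI Ix]].
  - have [IJ|JI] := Ftot _ _ FI FJ.
      by exists J => //; have [JD _ _] := Fav _ FJ; apply: JD => //; apply: IJ.
    by exists I => //; have [ID _ _] := Fav _ FI; apply: ID => //; apply: JI.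
  - by exists I => //; have [_ IM _] := Fav _ FI; apply: IM.
  - by have [_ _ InM] := Fav _ FI; apply: InM.
(* If the maximal [Q] were empty, [[set 0]] would be a strictly larger member of [avoiding]. *)
have Q0 : Q 0.
  apply: contrapT => nQ0.
  have Qempty x : ~ Q x by move=> /(QM 0); rewrite mul0r.
  apply: (Qmax [set 0]); first by split=> [x /Qempty//|/(_ 0 erefl)].
  split=> [a b -> ->|s a ->|x -> //]; first by rewrite /= addr0.
  by rewrite /= mulr0.
have meetsM a : ~ Q a -> exists q s, Q q /\ M (q + s * a).
  move=> nQa; apply: contrapT => nM.
  apply: (Qmax [set x | exists q s, Q q /\ x = q + s * a]).
    split=> [x Qx|QaQ]; first by exists x, 0; rewrite mul0r addr0.
    by apply: nQa; apply: QaQ; exists 0, 1; rewrite mul1r add0r.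
  split=> [x y [q [s [Qq ->]]] [q' [s' [Qq' ->]]]|t x [q [s [Qq ->]]]|].
  - by exists (q + q'), (s + s'); rewrite mulrDl addrACA; split=> //; apply: QD.
  - by exists (t * q), (t * s); rewrite mulrDr mulrA; split=> //; apply: QM.
  - by move=> x [q [s [Qq ->]]] Mx; apply: nM; exists q, s.
exists Q; split; last by rewrite -subset0 => x [/QnM].
split; first by split=> //; exists 0.
  by move=> QT; apply: (QnM 1) => //; rewrite QT.
move=> a b Qab; apply: contrapT => /not_orP[/meetsM[q [s [Qq Mq]]]].
move=> /meetsM[q' [s' [Qq' Mq']]]; apply: (QnM _ _ (MM _ _ Mq Mq')).
rewrite mulrDl; apply: (QD); first by rewrite mulrC; apply: QM.
rewrite mulrDr; apply: (QD); first by apply: QM.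
by rewrite mulrACA; apply: QM.
Qed.

End PrimeAvoidance.

Section Pseudocomplements.
Variable S : orderedSemiRing.
Hypotheses (S_idem : mul_idempotent S) (S_pos : positive_semiring S).
Hypothesis S_pcomp : pseudocomplemented S.
Implicit Types (s t x d : S) (P Q : set S).

Lemma ole0_eq s : s ⊑ 0 -> s = 0.
Proof. by move=> s0; apply: ole_anti; rewrite s0 S_pos. Qed.

Lemma add_eq0 s t : s + t = 0 -> s = 0 /\ t = 0.
Proof.
have addl_eq0 (u v : S) : u + v = 0 -> u = 0.
  move=> uv0; apply: ole0_eq; rewrite -uv0.
  by have := oleD2r u (S_pos v); rewrite add0r addrC.
by move=> st0; split; [apply: addl_eq0 st0|apply: (@addl_eq0 t s); rewrite addrC].
Qed.

Lemma pcomplP s : is_pcompl s (pcompl s).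
Proof.
have [t st] : Defs.pcomp S s by rewrite S_pcomp.
exact: (@xgetPex _ 0 [set t | is_pcompl s t] (ex_intro _ t st)).
Qed.

Lemma mul_pcompl s : s * pcompl s = 0.
Proof. by case: (pcomplP s). Qed.

Lemma ole_pcompl s x : s * x = 0 -> x ⊑ pcompl s.
Proof. by case: (pcomplP s) => _; apply. Qed.

(** From [x ⊑ pcompl s], multiplying by [x] gives [x = x ^+ 2 ⊑ pcompl s * x = 0]. *)
Lemma mul_eq0_of_pcompl s x : s * x = 0 -> pcompl s * x = 0 -> x = 0.
Proof.
move=> sx0 ssx0; apply: ole0_eq; rewrite -ssx0 -{1}(S_idem x) expr2.
exact: oleM2r (ole_pcompl sx0) (S_pos x).
Qed.

Lemma Dns_mul_eq0 d x : Dns S d -> d * x = 0 -> x = 0.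
Proof. by move=> [_ d0] dx0; apply: ole0_eq; rewrite -d0; apply: ole_pcompl. Qed.

Lemma Dns_add_pcompl s : Dns S (s + pcompl s).
Proof.
split; first by rewrite S_pcomp.
(* With [t] the pseudocomplement of the sum, [s * t + pcompl s * t = 0]; by positivity both summands
   vanish. *)
have := mul_pcompl (s + pcompl s).
by rewrite {1}mulrDl => /add_eq0[]; apply: mul_eq0_of_pcompl.
Qed.

Lemma pcompl1 : pcompl (1 : S) = 0.
Proof. by rewrite -[LHS]mul1r mul_pcompl. Qed.

Lemma pcompl0 : Stone S 1 -> pcompl (0 : S) = 1.
Proof. by case=> _ _; rewrite pcompl1 add0r. Qed.

Lemma ideal0 P : is_ideal P -> P 0.
Proof. by move=> [[a Pa] _ PM]; rewrite -(mul0r a); apply: PM. Qed.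

Lemma prime_ideal1 P : is_prime_ideal P -> ~ P 1.
Proof.
move=> [[_ _ PM] PnT _] P1; apply: PnT; rewrite -subTset => x _.
by rewrite -(mulr1 x); apply: PM.
Qed.

Lemma prime_ideal_pcompl P s : is_prime_ideal P -> ~ P s -> P (pcompl s).
Proof.
move=> [Pid _ Ppr] nPs; have := ideal0 Pid.
by rewrite -(mul_pcompl s) => /Ppr[].
Qed.

Lemma prime_ideal_Dns_not_minimal P d :
  is_prime_ideal P -> Dns S d -> P d -> ~ is_minimal_prime_ideal P.
Proof.
move=> Ppr Dd Pd [_ Pmin]; have [Pid _ PP] := Ppr.
(* The saturation of the multiplicative set generated by d and the complement
   of P; by idempotency no powers of d are needed. *)
pose M : set S := [set x | exists a c, ~ P a /\ x * c = a * d].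
have [||a b|Q [Qpr QM]] := @exists_prime_ideal_avoiding S M.
- by exists 1, d; split=> //; apply: prime_ideal1.
- move=> [a [c [nPa]]]; rewrite mul0r mulrC => /esym/(Dns_mul_eq0 Dd) a0.
  by apply: nPa; rewrite a0; apply: ideal0.
- move=> [x [c [nPx ac]]] [y [e [nPy be]]]; exists (x * y), (c * e).
  split; first by move=> /PP[].
  by rewrite mulrACA ac be mulrACA -[d * d]expr2 S_idem.
have Q_nM x : Q x -> ~ M x.
  by move=> Qx Mx; suff: (set0 : set S) x by []; rewrite -QM.
have QP : Q `<=` P.
  (* The complement of [P] lies in [M], as [x * d = x * d]. *)
  by move=> x Qx; apply: contrapT => nPx; apply: (Q_nM x Qx); exists x, d.
apply: (Q_nM d); first by rewrite (Pmin Q Qpr QP).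
by exists 1, 1; rewrite mulr1 mul1r; split=> //; apply: prime_ideal1.
Qed.

End Pseudocomplements.

Theorem theorem3p9 (S : orderedSemiRing)
    (S_idem : mul_idempotent S) (S_pos : positive_semiring S)
    (S_pcomp : pseudocomplemented S) (S_Stone1 : Stone S 1)
    (P : set S) (P_prime : is_prime_ideal P) :
  [<-> forall s : S, P s -> ~ P (pcompl s);
       forall s : S, P s -> P (pcompl (pcompl s));
       P `&` Dns S = set0;
       is_minimal_prime_ideal P].
Proof.
have [[_ PD _] _ _] := P_prime.
tfae.
- by move=> P1 s Ps; apply: prime_ideal_pcompl => //; apply: P1.
- move=> P2; rewrite -subset0 => s [/P2 Pss [_ s0]].
  (* For dense [s], the double pseudocomplement is that of [0], namely [1]. *)
  by move: Pss; rewrite s0 pcompl0 //; apply: prime_ideal1.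
- move=> P3; split=> // Q Qpr QP; rewrite eqEsubset; split=> // s Ps.
  apply: contrapT => nQs; suff: (set0 : set S) (s + pcompl s) by [].
  rewrite -P3; split; last exact: Dns_add_pcompl.
  by apply: PD => //; apply: QP; apply: prime_ideal_pcompl.
(* If [P] contained both [s] and [pcompl s], it would contain their sum, which is dense. *)
- move=> Pmin s Ps Pss.
  by apply: (prime_ideal_Dns_not_minimal _ _ _ P_prime (Dns_add_pcompl _ _ _ s))
    => //; apply: PD.
Qed.
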